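(* Let $n\ge2$, $x\in\mathbb{B}^n$ and $t>0$ with $1-t(1-|x|)>0$. Then $$B_\rho(x,r)\subset B_c(x,t)\subset B_\rho(x,R),$$ where $$r=\log\left(1+\frac{t(1-|x|)}{1+t(1-|x|)}\right)\qquad\text{and}\qquad R=\frac{2t(1-|x|)}{1-t(1-|x|)}.$$ Moreover, $R/r\to2$ as $t\to0$.
   Context: $\mathbb{B}^n=\{x\in\mathbb{R}^n:|x|<1\}$ with $|\cdot|$ the Euclidean norm. The Cassinian metric of $\mathbb{B}^n$ is $$c_{\mathbb{B}^n}(x,y)=\sup_{p\in\partial\mathbb{B}^n}\frac{|x-y|}{|x-p||p-y|}.$$ The hyperbolic metric of $\mathbb{B}^n$ is $$\rho_{\mathbb{B}^n}(x,y)=\inf_{\gamma}\int_\gamma\frac{2|dz|}{1-|z|^2},$$ the infimum being over all rectifiable curves $\gamma$ in $\mathbb{B}^n$ joining $x$ and $y$. The balls are $B_c(x,t)=\{y\in\mathbb{B}^n:c_{\mathbb{B}^n}(x,y)<t\}$ and $B_\rho(x,r)=\{y\in\mathbb{B}^n:\rho_{\mathbb{B}^n}(x,y)<r\}$. *)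

(* Defs.v *)
From HB Require Import structures.
From mathcomp Require Import all_boot all_order all_algebra.
From mathcomp Require Import all_classical all_reals all_analysis.

Set Implicit Arguments.
Unset Strict Implicit.
Unset Printing Implicit Defensive.

Import Order.TTheory GRing.Theory Num.Theory.
Import numFieldNormedType.Exports.

Local Open Scope classical_set_scope.
Local Open Scope ring_scope.

(* The norm carried by 'rV[R]_n in MathComp-Analysis is the sup norm; it has
   the same topology as the Euclidean norm [enorm], so [closure], [interior]
   and [continuous] below have their usual meaning in R^n. *)
Definition enorm (R : realType) (n : nat) (x : 'rV[R]_n) : R :=
  Num.sqrt (\sum_(i < n) x ord0 i ^+ 2).

Definition unit_ball (R : realType) (n : nat) : set 'rV[R]_n :=
  [set x | enorm x < 1].

Definition frontier (T : topologicalType) (A : set T) : set T :=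
  closure A `\` interior A.

Definition cassinian (R : realType) (n : nat) (D : set 'rV[R]_n)
    (x y : 'rV[R]_n) : \bar R :=
  ereal_sup [set (enorm (x - y) / (enorm (x - p) * enorm (p - y)))%:E
            | p in frontier D].

(* The vector-valued analogue of [variation]: length of the polygonal line
   through the values of [g] at the subdivision a :: s of [a, b]. *)
Definition polygon_length (R : realType) (n : nat) (a b : R)
    (g : R -> 'rV[R]_n) (s : seq R) : R :=
  let G := g \o nth b (a :: s) in
  \sum_(0 <= k < size s) enorm (G k.+1 - G k).

Definition curve_length (R : realType) (n : nat) (a b : R)
    (g : R -> 'rV[R]_n) : \bar R :=
  ereal_sup [set (polygon_length a b g s)%:E | s in itv_partition a b].

Definition rectifiable_curve (R : realType) (n : nat) (a b : R)
    (g : R -> 'rV[R]_n) : Prop :=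
  [/\ a < b, {within `[a, b], continuous g} &
      (curve_length a b g < +oo)%E].

(* Arc-length parametrization of a rectifiable curve [g] on [a, b].  The length
   of [g] on [a, u] is continuous and nondecreasing in [u], so the supremum is
   the last parameter [u] at which that length equals [s]
   (for 0 <= s <= curve_length a b g). *)
Definition arclength_param (R : realType) (n : nat) (a b : R)
    (g : R -> 'rV[R]_n) (s : R) : 'rV[R]_n :=
  g (sup [set u | a <= u <= b /\ (curve_length a u g <= s%:E)%E]).

(* The integral of [f] along [g] with respect to arc length. *)
Definition curve_integral (R : realType) (n : nat) (a b : R)
    (g : R -> 'rV[R]_n) (f : 'rV[R]_n -> R) : \bar R :=
  (\int[@lebesgue_measure R]_(s in `[0%R, fine (curve_length a b g)])
     (f (arclength_param a b g s))%:E)%E.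

Definition hyperbolic (R : realType) (n : nat) (x y : 'rV[R]_n) : \bar R :=
  ereal_inf [set v | exists a b (g : R -> 'rV[R]_n),
    [/\ rectifiable_curve a b g,
        g @` `[a, b] `<=` unit_ball (n := n),
        g a = x, g b = y &
        v = curve_integral a b g (fun z => 2 / (1 - enorm z ^+ 2))]].

Definition ball_c (R : realType) (n : nat) (x : 'rV[R]_n) (t : R) :
    set 'rV[R]_n :=
  [set y | unit_ball y /\ (cassinian (unit_ball (n := n)) x y < t%:E)%E].

Definition ball_rho (R : realType) (n : nat) (x : 'rV[R]_n) (r : R) :
    set 'rV[R]_n :=
  [set y | unit_ball y /\ (hyperbolic x y < r%:E)%E].

Definition inner_radius (R : realType) (n : nat) (x : 'rV[R]_n) (t : R) : R :=
  ln (1 + t * (1 - enorm x) / (1 + t * (1 - enorm x))).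

Definition outer_radius (R : realType) (n : nat) (x : 'rV[R]_n) (t : R) : R :=
  2 * t * (1 - enorm x) / (1 - t * (1 - enorm x)).

(* Main.v *)
Require Import Defs.
From mathcomp Require Import all_boot all_order all_algebra.
From mathcomp Require Import all_classical all_reals all_analysis.
From mathcomp Require Import ring lra.

Set Implicit Arguments.
Unset Strict Implicit.
Unset Printing Implicit Defensive.

Import Order.TTheory GRing.Theory Num.Theory.
Import numFieldNormedType.Exports.

Local Open Scope classical_set_scope.
Local Open Scope ring_scope.

(** Put d(z) = 1 - |z|, the distance from z to the sphere, e = |x - y| and
    s = t d(x) < 1.  The sphere is the frontier of the ball, so every boundary
    point p satisfies |x - p| >= d(x), and a radial projection p of x attains
    equality.  This turns the Cassinian metric into an inequality about e, d(x)
    and d(y) only, and the hyperbolic metric is then compared with the same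
    three numbers.

    Inner inclusion.  On a curve starting at x, the point at arc length u is
    within distance u of x, so there the density 2 / (1 - |z|^2), which is at
    least 1 / d(z), is at least 1 / (d(x) + u).  Integrating over the length l
    of the curve gives at least log (1 + l / d(x)), and l >= e, whence
    log (1 + e / d(x)) <= rho(x, y) ([ln_le_hyperbolic]).  If rho(x, y) is less
    than the inner radius, then e / d(x) < s / (1 + s); combined with
    d(y) >= d(x) - e this yields e < t d(x) d(y), and
    c(x, y) <= e / (d(x) d(y)) ([cassinian_le]) is less than t.

    Outer inclusion.  Let m = min (d(x), d(y)).  The straight segment from x to
    y stays at distance at least m from the sphere, and the density is at most
    2 / m there, so rho(x, y) <= 2 e / m ([hyperbolic_le_segment]).  If
    c(x, y) < t, testing the supremum at the boundary points nearest to x and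
    to y gives e < t m (m + e) ([cassinian_lt_chord]), that is
    e / m < t m / (1 - t m) <= s / (1 - s).

    Limit.  Apply w / (1 + w) <= log (1 + w) <= w at w = s / (1 + s):
    the quotient of the radii lies between 2 (1 + s) / (1 - s) and
    2 (1 + 2 s) / (1 - s). *)

(** * The Euclidean norm *)

Section EuclideanNorm.
Context {R : realType} {n : nat}.
Implicit Types x y z p : 'rV[R]_n.

Lemma enorm_ge0 x : 0 <= enorm x.
Proof. exact: sqrtr_ge0. Qed.

Lemma sqr_enorm x : enorm x ^+ 2 = \sum_(i < n) x ord0 i ^+ 2.
Proof. by rewrite sqr_sqrtr// sumr_ge0// => i _; exact: sqr_ge0. Qed.

Lemma enormZ (a : R) x : enorm (a *: x) = `|a| * enorm x.
Proof.
rewrite /enorm -sqrtr_sqr -sqrtrM ?sqr_ge0// mulr_sumr.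
by congr Num.sqrt; apply: eq_bigr => i _; rewrite mxE exprMn.
Qed.

Lemma enorm0 : enorm (0 : 'rV[R]_n) = 0.
Proof. by rewrite -(scale0r 0) enormZ normr0 mul0r. Qed.

Lemma enormN x : enorm (- x) = enorm x.
Proof. by rewrite -scaleN1r enormZ normrN1 mul1r. Qed.

Lemma enormBC x y : enorm (x - y) = enorm (y - x).
Proof. by rewrite -enormN opprB. Qed.

Lemma cauchy_schwarz x y :
  \sum_(i < n) x ord0 i * y ord0 i <= enorm x * enorm y.
Proof.
have [y0|y_neq0] := eqVneq (enorm y) 0.
  rewrite y0 mulr0 big1// => i _.
  have /eqP : enorm y ^+ 2 = 0 by rewrite y0 expr0n.
  rewrite sqr_enorm psumr_eq0 => [|j _]; last exact: sqr_ge0.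
  move=> /allP/(_ i); rewrite mem_index_enum sqrf_eq0 => /(_ isT)/eqP->.
  by rewrite mulr0.
have y_gt0 : 0 < enorm y ^+ 2 by rewrite exprn_gt0// lt_def y_neq0 enorm_ge0.
set C := \sum_(i < n) _.
apply: le_trans (ler_norm _) _.
rewrite -ler_sqr ?nnegrE ?mulr_ge0 ?enorm_ge0// real_normK ?num_real// exprMn.
rewrite -subr_ge0 -(pmulr_rge0 _ y_gt0).
(* Lagrange's identity: |y|^2 times the defect of the inequality is the
   squared norm of |y|^2 x - C y. *)
have -> : enorm y ^+ 2 * (enorm x ^+ 2 * enorm y ^+ 2 - C ^+ 2) =
    \sum_(i < n) (enorm y ^+ 2 * x ord0 i - C * y ord0 i) ^+ 2.
  have expand i : (enorm y ^+ 2 * x ord0 i - C * y ord0 i) ^+ 2 =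
      enorm y ^+ 2 ^+ 2 * x ord0 i ^+ 2
      - 2 * enorm y ^+ 2 * C * (x ord0 i * y ord0 i) + C ^+ 2 * y ord0 i ^+ 2.
    by ring.
  under eq_bigr do rewrite expand.
  by rewrite big_split sumrB/= -!mulr_sumr -!sqr_enorm -/C; ring.
by rewrite sumr_ge0// => i _; exact: sqr_ge0.
Qed.

Lemma ler_enormD x y : enorm (x + y) <= enorm x + enorm y.
Proof.
rewrite -ler_sqr ?nnegrE ?addr_ge0 ?enorm_ge0// sqrrD !sqr_enorm.
under eq_bigr do rewrite mxE sqrrD.
rewrite !big_split/= lerD2r lerD2l mulr2n.
by apply: lerD; exact: cauchy_schwarz.
Qed.

Lemma ler_enormB x y z : enorm (x - z) <= enorm (x - y) + enorm (y - z).
Proof. by rewrite (le_trans _ (ler_enormD _ _))// addrA subrK. Qed.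

Lemma lerB_enorm x y : enorm x - enorm y <= enorm (x - y).
Proof. by rewrite lerBlDr (le_trans _ (ler_enormD _ _))// subrK. Qed.

Lemma continuous_enorm : continuous (@enorm R n).
Proof.
move=> x; apply: continuous_comp; last exact: sqrt_continuous.
apply: continuous_big => [|i _ z]; first exact: add_continuous.
have -> : (fun y : 'rV[R]_n => y ord0 i ^+ 2) =
    (fun y : 'rV[R]_n => y ord0 i * y ord0 i) by apply/funext => y; rewrite expr2.
by apply: continuousM; exact: coord_continuous.
Qed.

End EuclideanNorm.

(** * The unit sphere as the frontier of the unit ball *)

Section BallFrontier.
Context {R : realType} {n : nat}.
Implicit Types x y z p : 'rV[R]_n.

Lemma open_unit_ball : open (@unit_ball R n).
Proof.
apply: (@open_comp _ _ (@enorm R n) [set r | r < 1]); last exact: open_lt.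
by move=> x _; exact: continuous_enorm.
Qed.

Lemma frontier_enorm_ge1 p : frontier (@unit_ball R n) p -> 1 <= enorm p.
Proof.
case=> _ pI; rewrite leNgt; apply/negP => p1; apply: pI.
by move/interior_id: open_unit_ball => ->.
Qed.

(** The points k p with k < 1 lie in the ball and tend to p. *)
Lemma frontier_enorm1 p : enorm p = 1 -> frontier (@unit_ball R n) p.
Proof.
move=> p1; split; last by move=> /interior_subset; rewrite /unit_ball/= p1 ltxx.
move=> B Bp.
have : \forall k \near 1^'-, B (k *: p).
  have kp : k *: p @[k --> (1 : R)^'-] --> p.
    rewrite -[X in _ --> X]scale1r.
    apply: cvg_at_left_filter.
    by apply: cvgZ; [exact: cvg_id|exact: cvg_cst].
  exact: kp.
move=> near_B.
near (1 : R)^'- => k.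
exists (k *: p); split; last by near: k.
rewrite /unit_ball/= enormZ p1 mulr1 ger0_norm; first by near: k; exact: nbhs_left_lt.
by near: k; exact: nbhs_left_ge.
Unshelve. all: by end_near. Qed.

Lemma exists_nearest_frontier x : (0 < n)%N -> enorm x < 1 ->
  exists2 p, frontier (@unit_ball R n) p & enorm (x - p) = 1 - enorm x.
Proof.
move=> n_gt0 x1.
have [p p1 xE] : exists2 p, enorm p = 1 & x = enorm x *: p.
  have [x0|x_neq0] := eqVneq (enorm x) 0.
    (* At the centre there is no radial direction: any unit vector will do. *)
    exists (delta_mx ord0 (Ordinal n_gt0)).
      rewrite /enorm (bigD1 (Ordinal n_gt0))//= mxE !eqxx expr1n.
      rewrite big1 ?addr0 ?sqrtr1// => i /negbTE ni.
      by rewrite mxE ni andbF expr0n.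
    rewrite x0 scale0r; apply/rowP => i; rewrite mxE.
    have := sqr_enorm x; rewrite x0 expr0n/= => /esym/eqP.
    rewrite psumr_eq0 => [/allP/(_ i)|j _]; last exact: sqr_ge0.
    by rewrite mem_index_enum sqrf_eq0 => /(_ isT)/eqP.
  exists ((enorm x)^-1 *: x); last by rewrite scalerA divff// scale1r.
  by rewrite enormZ ger0_norm ?invr_ge0 ?enorm_ge0// mulVf.
exists p; first exact: frontier_enorm1.
rewrite {1}xE -[X in _ - X]scale1r -scalerBl enormZ p1 mulr1 distrC.
by rewrite ger0_norm// subr_ge0 ltW.
Qed.

End BallFrontier.

(** * Curves and arc length *)

(** The integral of a nonnegative function is a supremum over the simple
    functions below it, hence monotone even for functions of unknown
    measurability, such as a density composed with the arc-length
    parametrization of an arbitrary rectifiable curve. *)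
Lemma ge0_integral_mono d (T : measurableType d) (R : realType)
    (mu : {measure set T -> \bar R}) (D : set T) (f g : T -> \bar R) :
  (forall x, D x -> 0 <= f x)%E -> (forall x, D x -> f x <= g x)%E ->
  (\int[mu]_(x in D) f x <= \int[mu]_(x in D) g x)%E.
Proof.
move=> f0 fg; rewrite !ge0_integralE//; last first.
  by move=> x Dx; exact: le_trans (f0 _ Dx) (fg _ Dx).
apply: le_ereal_sup => _ [h hf <-]; exists h => // x.
apply: le_trans (hf x) _; rewrite /patch; case: ifPn => //.
by rewrite inE => /fg.
Qed.

Section Curves.
Context {R : realType} {n : nat}.
Implicit Types (x y z p : 'rV[R]_n) (a b : R) (g : R -> 'rV[R]_n).

Lemma itv_partition_point a (s : seq R) : itv_partition a a s -> s = [::].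
Proof.
case: s => // c s [/= cs /eqP clast].
have /allP/(_ a) := order_path_min lt_trans (cs : path <%R a (c :: s)).
by rewrite ltxx -{1}clast mem_last => /(_ isT).
Qed.

Lemma curve_length_point a g : curve_length a a g = 0%E.
Proof.
apply/eqP; rewrite eq_le; apply/andP; split.
  apply: ge_ereal_sup => _ [s /itv_partition_point-> <-].
  by rewrite /polygon_length big_nil.
apply: ereal_sup_ubound; exists [::]; first by split.
by rewrite /polygon_length big_nil.
Qed.

Lemma chord_le_curve_length a b g : a <= b ->
  ((enorm (g b - g a))%:E <= curve_length a b g)%E.
Proof.
rewrite le_eqVlt => /predU1P[->|ab].
  by rewrite subrr enorm0 curve_length_point.
apply: ereal_sup_ubound; exists [:: b]; first by split=> /=; rewrite ?ab.
by rewrite /polygon_length big_nat1.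
Qed.

Lemma curve_length_ge0 a b g : a <= b -> (0 <= curve_length a b g)%E.
Proof.
move=> ab; apply: le_trans (chord_le_curve_length g ab).
by rewrite lee_fin enorm_ge0.
Qed.

(** The point at arc length s is some g u, and its distance to the starting
    point is at most s.  For parameters below the supremum that defines it, the
    chord is at most the length; continuity of g carries this bound over to the
    supremum itself. *)
Lemma arclength_paramP a b g (s : R) : rectifiable_curve a b g -> 0 <= s ->
  exists u, [/\ a <= u <= b, arclength_param a b g s = g u &
                enorm (g u - g a) <= s].
Proof.
case=> ab /subspace_continuousP gcont _ s0.
rewrite /arclength_param; set A := [set u | _].
have Aa : A a by rewrite /A/= lexx (ltW ab) curve_length_point lee_fin.
have ubA : ubound A b by move=> u [/andP[]].
have nonA : A !=set0 by exists a.
have bndA : has_ubound A by exists b.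
have supA : a <= sup A <= b by rewrite (ub_le_sup bndA Aa) (ge_sup nonA ubA).
exists (sup A); split=> //.
rewrite leNgt; apply/negP => far.
have dist_cont : continuous (fun z => enorm (z - g a)).
  move=> z; apply: continuous_comp; last exact: continuous_enorm.
  exact: (cvgB cvg_id (cvg_cst _)).
have supAab : sup A \in `[a, b] by rewrite /= in_itv.
(* If the chord at the supremum were too long, so would be the chords at all
   nearby parameters, some of which belong to A. *)
have near_far : \forall u \near sup A, u \in `[a, b] -> s < enorm (g u - g a).
  have := cvg_comp _ _ (gcont (sup A) supAab) (dist_cont (g (sup A))).
  by move=> /(_ _ (open_nbhs_nbhs (conj (@open_gt _ s) far))).
have [u [[aub us]]] := closure_sup nonA bndA near_far.
rewrite /= in_itv/= => /(_ aub).
have /andP[au _] := aub.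
by rewrite ltNge -lee_fin (le_trans (chord_le_curve_length g au)).
Qed.

End Curves.

(** * Two-sided bounds for the hyperbolic metric *)

Section HyperbolicBounds.
Context {R : realType} {n : nat}.
Implicit Types (x y z p : 'rV[R]_n) (a b : R) (g : R -> 'rV[R]_n).

Lemma integral_invDx (d l : R) : 0 < d -> 0 <= l ->
  (\int[@lebesgue_measure R]_(s in `[0%R, l]) ((d + s)^-1)%:E =
   (ln (1 + l / d))%:E)%E.
Proof.
move=> d0; rewrite le_eqVlt => /predU1P[<-|l0].
  by rewrite set_itv1 integral_set1 mul0r addr0 ln1.
have ds_gt0 (s : R) : 0 <= s -> 0 < d + s by move=> s0; rewrite ltr_wpDr.
have cD : continuous (fun s : R => d + s).
  by move=> s; exact: (cvgD (cvg_cst _) cvg_id).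
have cF (s : R) : 0 <= s -> ln (d + u) @[u --> s] --> ln (d + s).
  move=> s0; apply: continuous_comp; first exact: cD.
  exact: continuous_ln (ds_gt0 _ s0).
have dF (s : R) : 0 < s -> is_derive s (1 : R) (fun u => ln (d + u)) (d + s)^-1.
  move=> s0.
  have -> : (d + s)^-1 = (d + s)^-1 * (0 + 1) by rewrite add0r mulr1.
  apply: is_derive1_comp.
  exact: is_derive1_ln (ds_gt0 _ (ltW s0)).
rewrite (@continuous_FTC2 R _ (fun u => ln (d + u))) //.
- rewrite -EFinB addr0 -ln_div ?posrE ?ds_gt0 ?ltW//.
  by rewrite mulrDl divff ?gt_eqF.
- apply: continuous_in_subspaceT => s; rewrite inE/= in_itv/= => /andP[s0 _].
  by apply: cvgV; [rewrite gt_eqF ?ds_gt0|exact: cD].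
- split.
  + by move=> s; rewrite in_itv/= => /andP[s0 _]; have [] := dF _ s0.
  + by apply: cvg_at_right_filter; exact: cF.
  + by apply: cvg_at_left_filter; exact: cF (ltW l0).
- move=> s; rewrite in_itv/= => /andP[s0 _].
  by rewrite derive1E; have [_ ->] := dF _ s0.
Qed.

Definition hyperbolic_density z : R := 2 / (1 - enorm z ^+ 2).

(** Since 1 - |z|^2 = (1 - |z|) (1 + |z|) with 1 <= 1 + |z| < 2, the density
    lies between 1 / (1 - |z|) and 2 / (1 - |z|). *)
Lemma hyperbolic_density_ge z (w : R) :
  enorm z < 1 -> 1 - enorm z <= w -> w^-1 <= hyperbolic_density z.
Proof.
move=> z1 zw; have z0 := enorm_ge0 z.
have z1' : 0 < 1 - enorm z by rewrite subr_gt0.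
have w0 := lt_le_trans z1' zw.
rewrite /hyperbolic_density -[w^-1]mul1r ler_pdivrMr// mulrAC ler_pdivlMr; nra.
Qed.

Lemma hyperbolic_density_le z (m : R) :
  0 < m -> enorm z <= 1 - m -> hyperbolic_density z <= 2 / m.
Proof.
move=> m0 zm; have z0 := enorm_ge0 z.
rewrite /hyperbolic_density ler_pdivrMr; last nra.
by rewrite mulrAC ler_pdivlMr//; nra.
Qed.

(** Along any curve from x, the point at arc length s has norm at least |x| - s,
    so its density is at least 1 / (1 - |x| + s). *)
Lemma ln_le_hyperbolic x y : enorm x < 1 ->
  ((ln (1 + enorm (x - y) / (1 - enorm x)))%:E <= hyperbolic x y)%E.
Proof.
move=> x1; have d0 : 0 < 1 - enorm x by rewrite subr_gt0.
apply: le_ereal_inf_tmp => _ [a [b [g [rect_g g_ball gax gby ->]]]].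
move: x1 d0; rewrite -gax -gby => x1 d0.
have [ab _ fin_len] := rect_g.
have len0 := curve_length_ge0 g (ltW ab).
have lenE : curve_length a b g = (fine (curve_length a b g))%:E.
  by rewrite fineK// ge0_fin_numE.
rewrite /curve_integral; set l := fine _ in lenE *.
have l0 : 0 <= l by rewrite -lee_fin -lenE.
have chord_l : enorm (g a - g b) <= l.
  by rewrite enormBC -lee_fin -lenE chord_le_curve_length// ltW.
apply: le_trans (_ : (ln (1 + l / (1 - enorm (g a))))%:E <= _)%E.
  have chord0 := enorm_ge0 (g a - g b).
  have pos (c : R) : 0 <= c -> 0 < 1 + c / (1 - enorm (g a)).
    by move=> c0; rewrite ltr_wpDr// divr_ge0// ltW.
  rewrite lee_fin ler_ln ?posrE ?pos//.
  by rewrite lerD2l ler_pM2r ?invr_gt0.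
rewrite -integral_invDx//; apply: ge0_integral_mono => s /=;
    rewrite in_itv/= => /andP[s0 _]; rewrite lee_fin.
  by rewrite invr_ge0 addr_ge0// ltW.
have [u [u01 -> gu_le]] := arclength_paramP rect_g s0.
apply: hyperbolic_density_ge; first by apply: g_ball; exists u; rewrite //= in_itv.
by have := lerB_enorm (g a) (g u); rewrite enormBC; lra.
Qed.

Definition segment x y (u : R) := x + u *: (y - x).

(** Every polygon inscribed in the segment has length |y - x| times the
    variation of the identity on [0, 1]. *)
Lemma segment_length x y :
  (curve_length 0 1 (segment x y) <= (enorm (y - x))%:E)%E.
Proof.
apply: ge_ereal_sup => _ [s s01 <-]; rewrite lee_fin.
have -> : polygon_length 0 1 (segment x y) s =
    enorm (y - x) * variation 0 1 id s.
  rewrite /polygon_length /variation mulr_sumr; apply: eq_bigr => k _ /=.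
  by rewrite /segment opprD addrACA subrr add0r -scalerBl enormZ mulrC.
rewrite (nondecreasing_variation _ s01); last by move=> ? ? _ _.
by rewrite subr0 mulr1.
Qed.

(** The segment is a competitor in the infimum; by convexity of the norm it
    stays in the ball of radius 1 - m, where the density is at most 2 / m. *)
Lemma hyperbolic_le_segment x y (m : R) : 0 < m ->
  enorm x <= 1 - m -> enorm y <= 1 - m ->
  (hyperbolic x y <= (2 * enorm (x - y) / m)%:E)%E.
Proof.
move=> m0 xm ym; set g := segment x y.
have in_ball (u : R) : 0 <= u <= 1 -> enorm (g u) <= 1 - m.
  move=> /andP[u0 u1].
  have -> : g u = (1 - u) *: x + u *: y.
    by rewrite /g /segment scalerBr scalerBl scale1r addrCA addrC -addrA.
  apply: le_trans (ler_enormD _ _) _.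
  rewrite !enormZ !ger0_norm ?subr_ge0//; nra.
have len_le : (curve_length 0 1 g <= (enorm (x - y))%:E)%E.
  by rewrite enormBC; exact: segment_length.
have rect_g : rectifiable_curve 0 1 g.
  split; [exact: ltr01| |exact: le_lt_trans len_le (ltry _)].
  apply: continuous_subspaceT => u.
  apply: (cvgD (cvg_cst _)); exact: (cvgZ cvg_id (cvg_cst _)).
apply: le_trans (_ : curve_integral 0 1 g hyperbolic_density <= _)%E.
  apply: ereal_inf_lbound; exists 0, 1, g; split => //.
  - move=> _ [u u01 <-]; rewrite /= in_itv/= in u01.
    by have := in_ball u u01; rewrite /unit_ball/=; lra.
  - by rewrite /g /segment scale0r addr0.
  - by rewrite /g /segment scale1r addrC subrK.
have len0 := curve_length_ge0 g (ler01 : 0 <= (1 : R)).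
rewrite /curve_integral; set l := fine _.
have l0 : 0 <= l by exact: fine_ge0.
have l_le : l <= enorm (x - y).
  by rewrite -lee_fin fineK// ge0_fin_numE// (le_lt_trans len_le (ltry _)).
apply: le_trans (_ : \int[@lebesgue_measure R]_(s in `[0%R, l]) (2 / m)%:E <= _)%E.
  apply: ge0_integral_mono => s /=; rewrite in_itv/= => /andP[s0 _]; rewrite lee_fin;
    have [u [u01 -> _]] := arclength_paramP rect_g s0; have gu := in_ball u u01.
    have gu0 := enorm_ge0 (g u).
    by rewrite /hyperbolic_density divr_ge0//; nra.
  exact: hyperbolic_density_le.
rewrite integral_cst//= lebesgue_measure_itv/= lte_fin.
case: ifPn => _; last first.
  by rewrite mule0 lee_fin divr_ge0 ?mulr_ge0 ?enorm_ge0// ltW.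
by rewrite -EFinB -EFinM lee_fin subr0 mulrAC ler_pM2r ?invr_gt0// ler_pM2l.
Qed.

End HyperbolicBounds.

(** * Bounds for the Cassinian metric *)

Section CassinianBounds.
Context {R : realType} {n : nat}.
Implicit Types x y z p : 'rV[R]_n.

Lemma cassinian_le x y : enorm x < 1 -> enorm y < 1 ->
  (cassinian (@unit_ball R n) x y <=
   (enorm (x - y) / ((1 - enorm x) * (1 - enorm y)))%:E)%E.
Proof.
move=> x1 y1; apply: ge_ereal_sup => _ [p /frontier_enorm_ge1 p1 <-].
have dx : 0 < 1 - enorm x by lra.
have dy : 0 < 1 - enorm y by lra.
have xp : 1 - enorm x <= enorm (x - p).
  by rewrite enormBC; have := lerB_enorm p x; lra.
have py : 1 - enorm y <= enorm (p - y) by have := lerB_enorm p y; lra.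
rewrite lee_fin ler_wpM2l ?enorm_ge0// lef_pV2 ?posrE ?mulr_gt0//.
- by rewrite ler_pM// ltW.
- exact: lt_le_trans xp.
- exact: lt_le_trans py.
Qed.

Lemma cassinian_lt_frontier x y p (t : R) : enorm x < 1 -> enorm y < 1 ->
  (cassinian (@unit_ball R n) x y < t%:E)%E -> frontier (@unit_ball R n) p ->
  enorm (x - y) < t * (enorm (x - p) * enorm (p - y)).
Proof.
move=> x1 y1 ct pF; have p1 := frontier_enorm_ge1 pF.
have xp : 0 < enorm (x - p).
  by rewrite enormBC; have := lerB_enorm p x; lra.
have py : 0 < enorm (p - y) by have := lerB_enorm p y; lra.
rewrite -ltr_pdivrMr ?mulr_gt0// -lte_fin; apply: le_lt_trans ct.
by apply: ereal_sup_ubound; exists p.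
Qed.

(** Test the supremum at the boundary point p nearest to x: |x - p| is the
    distance of x to the sphere, and |p - y| <= |p - x| + |x - y|.  The same
    with x and y exchanged gives the bound for the smaller of the two
    distances. *)
Lemma cassinian_lt_chord x y (t : R) : (0 < n)%N -> 0 <= t ->
  enorm x < 1 -> enorm y < 1 -> (cassinian (@unit_ball R n) x y < t%:E)%E ->
  let m := Num.min (1 - enorm x) (1 - enorm y) in
  enorm (x - y) < t * m * (m + enorm (x - y)).
Proof.
move=> n0 t0 x1 y1 ct /=.
have [p pF xp] := exists_nearest_frontier n0 x1.
have [q qF yq] := exists_nearest_frontier n0 y1.
have bp := cassinian_lt_frontier x1 y1 ct pF.
have bq := cassinian_lt_frontier x1 y1 ct qF.
have py : enorm (p - y) <= 1 - enorm x + enorm (x - y).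
  by rewrite -xp [enorm (x - p)]enormBC ler_enormB.
have xq : enorm (x - q) <= 1 - enorm y + enorm (x - y).
  by rewrite -yq [leRHS]addrC ler_enormB.
have xy0 := enorm_ge0 (x - y).
case: (leP (1 - enorm x) (1 - enorm y)) => _.
  apply: lt_le_trans bp _; rewrite xp -mulrA.
  by rewrite !ler_wpM2l//; lra.
apply: lt_le_trans bq _; rewrite (enormBC q) yq -mulrA (mulrC (enorm (x - q))).
by rewrite !ler_wpM2l//; lra.
Qed.

End CassinianBounds.

(** * The quotient of the radii *)

Section Limit.
Context {R : realType}.

(** This is the upper bound log (1 + v) <= v at v = - w / (1 + w), because
    1 + v = 1 / (1 + w). *)
Lemma ge_ln1Dx (w : R) : 0 <= w -> w / (1 + w) <= ln (1 + w).
Proof.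
move=> w0; have w1 : 0 < 1 + w by lra.
rewrite -[ln _]opprK -lnV ?posrE// lerNr.
have inv1w : (1 + w)^-1 = 1 + - (w / (1 + w)) by field; lra.
rewrite {1}inv1w.
by apply: le_ln1Dx; rewrite ltrN2 ltr_pdivrMr//; lra.
Qed.

Lemma cvg_radii_ratio (d : R) : 0 < d ->
  2 * t * d / (1 - t * d) / ln (1 + t * d / (1 + t * d)) @[t --> 0^'+] --> (2 : R).
Proof.
move=> d0.
have cvg_bound (k : R) : 2 * (1 + k * (t * d)) / (1 - t * d) @[t --> 0^'+] --> (2 : R).
  have ctd : (fun t : R => t * d) @ (0 : R) --> 0 * d.
    exact: (cvgM cvg_id (cvg_cst _)).
  have : 2 * (1 + k * (t * d)) / (1 - t * d) @[t --> (0 : R)] -->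
      2 * (1 + k * (0 * d)) / (1 - 0 * d).
    apply: cvgM.
      apply: cvgM; first exact: cvg_cst.
      by apply: cvgD; [|apply: cvgM => //]; exact: cvg_cst.
    apply: cvgV; first by rewrite mul0r subr0 oner_eq0.
    by apply: cvgB => //; exact: cvg_cst.
  rewrite mul0r mulr0 subr0 addr0 mulr1 divr1; exact: cvg_at_right_filter.
apply: squeeze_cvgr (cvg_bound 1) (cvg_bound 2).
near=> t.
have t0 : 0 < t by near: t; exact: nbhs_right_gt.
have td1 : t * d < 1.
  by rewrite -ltr_pdivlMr// mul1r; near: t; apply: nbhs_right_lt; rewrite invr_gt0.
have s0 : 0 < t * d by rewrite mulr_gt0.
rewrite -(mulrA 2 t d); set s := t * d in td1 s0 *.
have w0 : 0 < s / (1 + s) by rewrite divr_gt0//; lra.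
have ln_up : ln (1 + s / (1 + s)) <= s / (1 + s) by apply: le_ln1Dx; lra.
(* With w = s / (1 + s), the lower bound w / (1 + w) equals s / (1 + 2 s). *)
have ln_lo : s / (1 + 2 * s) <= ln (1 + s / (1 + s)).
  have -> : s / (1 + 2 * s) = s / (1 + s) / (1 + s / (1 + s)).
    by field; lra.
  by apply: ge_ln1Dx; exact: ltW.
have ln0 : 0 < ln (1 + s / (1 + s)) by apply: lt_le_trans ln_lo; rewrite divr_gt0//; lra.
have k_ge0 (k : R) : 0 <= k -> 0 <= 2 * (1 + k * s) / (1 - s).
  move=> k0; have ks0 : 0 <= k * s by rewrite mulr_ge0// ltW.
  by rewrite divr_ge0//; lra.
apply/andP; split.
  rewrite ler_pdivlMr//; apply: le_trans (ler_wpM2l (k_ge0 1 ler01) ln_up) _.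
  by rewrite le_eqVlt; apply/orP; left; apply/eqP; field; lra.
rewrite ler_pdivrMr//; apply: le_trans (ler_wpM2l (k_ge0 2 (ler0n R 2)) ln_lo).
by rewrite le_eqVlt; apply/orP; left; apply/eqP; field; lra.
Unshelve. all: by end_near. Qed.

End Limit.

(** * The inclusions of balls *)

Unset Implicit Arguments.

Theorem theorem5p6 (R : realType) (n : nat) (hn : (2 <= n)%N)
    (x : 'rV[R]_n) (hx : unit_ball x) :
  (forall t : R, 0 < t -> 0 < 1 - t * (1 - enorm x) ->
     ball_rho x (inner_radius x t) `<=` ball_c x t /\
     ball_c x t `<=` ball_rho x (outer_radius x t)) /\
  (outer_radius x t / inner_radius x t @[t --> 0^'+] --> (2 : R)).
Proof.
have x1 : enorm x < 1 := hx.
have d0 : 0 < 1 - enorm x by rewrite subr_gt0.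
split; last by apply: cvg_radii_ratio.
move=> t t0 s1.
have s0 : 0 < t * (1 - enorm x) by rewrite mulr_gt0.
split=> y [y_ball].
- move=> rho_lt; have y1 : enorm y < 1 := y_ball; split=> //.
  have dy : 0 < 1 - enorm y by rewrite subr_gt0.
  have xy0 := enorm_ge0 (x - y).
  have := le_lt_trans (ln_le_hyperbolic y x1) rho_lt.
  have q0 : 0 <= enorm (x - y) / (1 - enorm x) by rewrite divr_ge0// ltW.
  have w0 : 0 < t * (1 - enorm x) / (1 + t * (1 - enorm x)).
    by rewrite divr_gt0//; lra.
  (* Here |x - y| / (1 - |x|) is bounded by s / (1 + s), s = t (1 - |x|). *)
  rewrite lte_fin ltr_ln ?posrE; [|lra|lra].
  rewrite ltrD2l ltr_pdivrMr// mulrAC ltr_pdivlMr; last by lra.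
  move=> xy_lt; apply: le_lt_trans (cassinian_le x1 y1) _.
  rewrite lte_fin ltr_pdivrMr ?mulr_gt0//.
  have dxy : 1 - enorm x <= enorm (x - y) + (1 - enorm y).
    by have := lerB_enorm y x; rewrite enormBC; lra.
  nra.
- move=> c_lt; have y1 : enorm y < 1 := y_ball; split=> //.
  have := cassinian_lt_chord (ltnW hn) (ltW t0) x1 y1 c_lt.
  set m := Num.min _ _ => /= xy_lt.
  have m0 : 0 < m by rewrite lt_min d0 subr_gt0.
  have mx : m <= 1 - enorm x by rewrite ge_min lexx.
  have my : m <= 1 - enorm y by rewrite ge_min lexx orbT.
  have tm_le : t * m <= t * (1 - enorm x) by rewrite ler_pM2l.
  apply: le_lt_trans (hyperbolic_le_segment (x := x) (y := y) m0 _ _) _; [lra|lra|].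
  have xy0 := enorm_ge0 (x - y).
  rewrite lte_fin /outer_radius ltr_pdivrMr// mulrAC ltr_pdivlMr//.
  (* |x - y| (1 - s) <= |x - y| (1 - t m) < t m^2 <= s m. *)
  nra.
Qed.
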